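(* Let $n\in\mathbb{N}$ and $\varepsilon>0$ be given, and assume that $n\geqslant 2$ and $\varepsilon<\frac{1}{32n^2}$. Let $\mathcal{G}\subseteq M_n(\mathbb{C})$ be a group of unitary matrices such that every element of $\mathcal{G}$ is a product of a commutator of two elements of $\mathcal{G}$ and a scalar. If $\mathcal{G}$ has a weak $\varepsilon$-approximate fixed point $\xi\in\mathbb{C}^n$, then $\mathcal{G}$ has a common eigenvector $\eta$ such that $\|\xi-\eta\|\leqslant 4\sqrt{2\varepsilon}<\frac{1}{n}$.
   Context: The commutator of $A,B\in\mathcal{G}$ is $[A,B]=ABA^{-1}B^{-1}$; the hypothesis says that each $G\in\mathcal{G}$ equals $\lambda[A,B]$ for some $A,B\in\mathcal{G}$ and some $\lambda\in\mathbb{C}$. $\mathbb{C}^n$ carries the standard inner product and $\|\cdot\|$ is the Euclidean norm. For $0<\varepsilon<1$, a vector $\xi\in\mathbb{C}^n$ with $\|\xi\|=1$ is a weak $\varepsilon$-approximate fixed point of $\mathcal{G}$ if $|\langle G\xi,\xi\rangle|\geqslant 1-\varepsilon$ for all $G\in\mathcal{G}$. A common eigenvector of $\mathcal{G}$ is a vector $\eta$ with $\|\eta\|=1$ such that for every $G\in\mathcal{G}$ there is a scalar $\lambda\in\mathbb{C}$ with $G\eta=\lambda\eta$. *)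

(* Defs.v *)
From mathcomp Require Import all_boot all_order all_algebra.
From mathcomp Require Import classical_sets reals complex.

Set Implicit Arguments.
Unset Strict Implicit.
Unset Printing Implicit Defensive.

Import Order.TTheory GRing.Theory Num.Theory.

Local Open Scope ring_scope.
Local Open Scope complex_scope.

Section Definitions.

Context {R : realType} {n : nat}.

Local Notation C := R[i].
Implicit Types (A B : 'M[C]_n) (G : set 'M[C]_n) (u v : 'cV[C]_n) (e : R).

(* [dotmx] acts on row vectors; it is linear in its first argument and
   conjugate-linear in its second one. *)
Definition inner u v : C := dotmx u^T v^T.

(* <u, u> is a nonnegative real number, so taking its real part only moves it
   from C to R. *)
Definition norm2 u : R := Num.sqrt (complex.Re (inner u u)).

Definition unitary_group G : Prop :=
  [/\ forall A, G A -> A \is unitarymx,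
      G 1%:M,
      forall A B, G A -> G B -> G (A *m B)
    & forall A, G A -> G (invmx A)].

Definition mxcommutator A B : 'M[C]_n := A *m B *m invmx A *m invmx B.

(* On R[i], [`|z|] is R[i]-valued and [x <= y] means that [y - x] is a
   nonnegative real. *)
Definition is_weak_approx_fixed_point G e u : Prop :=
  norm2 u = 1 /\ forall A, G A -> (1 - e)%:C <= `|inner (A *m u) u|.

Definition is_common_eigenvector G u : Prop :=
  norm2 u = 1 /\ forall A, G A -> exists c : C, A *m u = c *: u.

End Definitions.

(* Main.v *)
Require Import Defs.
From mathcomp Require Import all_boot all_order all_algebra.
From mathcomp Require Import classical_sets reals complex.
From mathcomp Require Import topology normedtype derive ring lra zify.
Import Order.TTheory GRing.Theory Num.Theory.
Local Open Scope ring_scope.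

(** Write [d = 4 sqrt(2 eps)], so that [n d < 1].

    Every [A] in the group almost fixes [xi] up to a phase: with
    [a = <A xi, xi> / |<A xi, xi>|], the vector [A xi] lies within
    [sqrt(2 eps)] of [a xi] ([near_phase]).  The phases cancel in a commutator,
    hence every commutator moves [xi] by at most [d] ([mxcommutator_near]).

    Let [K] be the set of the elements of determinant 1 which move [xi] by at
    most [d].  It contains all commutators, and the point is that it is closed
    under multiplication, although the obvious bound for a product is [2 d].
    Indeed let [A], [B] be in [K] and write [A B = c C] with [C] a commutator.
    Taking determinants, [c ^ n = 1].  Comparing [A B xi] with [xi] and with
    [c xi], one gets [|c - 1| <= 3 d < 3 / n].  But a nontrivial [n]-th root of
    unity is at distance at least [4 / n] from 1 ([root1_gap]), so [c = 1] and
    [A B = C] is a commutator.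

    A semigroup of unitary matrices which keeps [xi] in the half-space
    [1 - d^2 / 2 <= Re <v, xi>] has a fixed vector [v] in that half-space, of
    norm at most 1: the point of smallest norm of the closed convex hull of the
    orbit of [xi] ([fixed_point]).  Since each element of the group is a scalar
    multiple of an element of [K], [v] is a common eigenvector.  Normalizing
    [v] can only increase [Re <v, xi>], and for unit vectors the condition
    [1 - d^2 / 2 <= Re <v, xi>] says exactly that [v] is within [d] of [xi]. *)

(** * Distance between the roots of unity *)

Lemma sum_minn_le p : (4 * \sum_(k < p) minn k (p - k) <= p ^ 2)%N.
Proof.
elim/ltn_ind: p => [] [|[|p]] IH; first by rewrite big_ord0.
  by rewrite big_ord1.
(* The terms at [k = 0] and [k = p + 1] are 0 and 1; each of the others
   exceeds by one a term of the sum for [p]. *)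
have -> : (\sum_(k < p.+2) minn k (p.+2 - k) =
           p.+1 + \sum_(k < p) minn k (p - k))%N.
  rewrite big_ord_recl min0n add0n.
  have -> : (p.+1 + \sum_(k < p) minn k (p - k) =
             \sum_(k < p.+1) (1 + minn k (p - k)))%N.
    by rewrite big_split /= sum1_card card_ord big_ord_recr /= subnn minn0 addn0.
  by apply: eq_bigr => k _; rewrite /= /bump /=; have := ltn_ord k; lia.
by have := IH p (leqW (leqnn _)); lia.
Qed.

(** The powers of [z] sum to 0, so [n] is the sum of the [1 - z ^ k].  Walking
    around the circle from [1] to [z ^ k] by the shorter of the two ways shows
    that [|1 - z ^ k|] is at most [min(k, n - k) |z - 1|], and the coefficients
    sum to at most [n ^ 2 / 4]. *)
Lemma root1_gap (K : numDomainType) (n : nat) (z : K) :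
  (0 < n)%N -> z ^+ n = 1 -> z != 1 -> 4 <= n%:R * `|z - 1|.
Proof.
move=> n0 zn z1.
have nz : `|z| = 1.
  by apply/eqP; rewrite -(pexpr_eq1 n0) // -normrX zn normr1.
have le_k k : `|z ^+ k - 1| <= k%:R * `|z - 1|.
  elim: k => [|k IH]; first by rewrite subrr normr0 mul0r.
  have -> : z ^+ k.+1 - 1 = z ^+ k * (z - 1) + (z ^+ k - 1).
    by rewrite exprSr; ring.
  rewrite (le_trans (ler_normD _ _)) // normrM normrX nz expr1n mul1r.
  by rewrite -natr1 mulrDl mul1r addrC lerD.
have le_m (k : 'I_n) : `|z ^+ k - 1| <= (minn k (n - k))%:R * `|z - 1|.
  have [_|_] := leqP k (n - k); first exact: le_k.
  suff -> : `|z ^+ k - 1| = `|z ^+ (n - k) - 1| by exact: le_k.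
  have -> : z ^+ (n - k) - 1 = z ^+ (n - k) * (1 - z ^+ k).
    by rewrite mulrBr mulr1 -exprD subnK ?zn // ltnW.
  by rewrite normrM normrX nz expr1n mul1r distrC.
have sum0 : \sum_(k < n) z ^+ k = 0.
  apply/eqP; have /eqP := subrX1 z n.
  by rewrite zn subrr eq_sym mulf_eq0 subr_eq0 (negPf z1).
have le_n : n%:R <= (\sum_(k < n) minn k (n - k))%:R * `|z - 1|.
  have <- : `|\sum_(k < n) (z ^+ k - 1)| = n%:R.
    by rewrite sumrB sum0 sub0r normrN sumr_const card_ord normr_nat.
  rewrite natr_sum mulr_suml (le_trans (ler_norm_sum _ _ _)) //.
  by apply: ler_sum => k _; exact: le_m.
have n_gt0 : 0 < n%:R :> K by rewrite ltr0n.
rewrite -(ler_pM2l n_gt0) mulrA -expr2 -natrX.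
apply: le_trans (_ : (4 * \sum_(k < n) minn k (n - k))%:R * `|z - 1| <= _).
  by rewrite natrM -mulrA mulrC ler_pM2l ?ltr0n.
by rewrite ler_wpM2r // ler_nat sum_minn_le.
Qed.

(** * The real inner product and the Euclidean norm *)

Section RealInnerProduct.

Set Implicit Arguments.
Unset Strict Implicit.

Context {R : realType} {n : nat}.
Local Notation C := R[i].
Local Notation normc := ComplexField.Normc.normc.
Implicit Types (A B : 'M[C]_n) (u v w : 'cV[C]_n) (c : C) (a : R).

(** The Euclidean structure of [C^n] as a real vector space of dimension [2n].
    The value is locked because comparing two of them up to conversion would
    unfold the sesquilinear form. *)
Definition rdot u v : R := locked (complex.Re (inner u v)).

Lemma rdot_inner u v : rdot u v = complex.Re (inner u v).
Proof. by rewrite /rdot -lock. Qed.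

Lemma innerE u v : inner u v = \sum_i u i 0 * (v i 0)^*.
Proof.
by rewrite /inner dotmxE mxE; apply: eq_bigr => i _; rewrite !mxE.
Qed.

Lemma innerZr c u v : inner u (c *: v) = c^* * inner u v.
Proof.
rewrite !innerE mulr_sumr; apply: eq_bigr => i _.
by rewrite mxE rmorphM mulrCA.
Qed.

Lemma rdotE u v : rdot u v =
  \sum_i (complex.Re (u i 0) * complex.Re (v i 0) +
          complex.Im (u i 0) * complex.Im (v i 0)).
Proof.
rewrite rdot_inner innerE raddf_sum; apply: eq_bigr => i _.
by case: (u i 0) (v i 0) => [x y] [z t] /=; ring.
Qed.

Lemma rdotC u v : rdot u v = rdot v u.
Proof. by rewrite !rdotE; apply: eq_bigr => i _; ring. Qed.

Lemma rdotDl u v w : rdot (u + v) w = rdot u w + rdot v w.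
Proof.
rewrite !rdotE -big_split /=; apply: eq_bigr => i _.
by rewrite mxE; case: (u i 0) (v i 0) => [x y] [z t] /=; ring.
Qed.

Lemma rdotZl a u w : rdot (a%:C%C *: u) w = a * rdot u w.
Proof.
rewrite !rdotE big_distrr /=; apply: eq_bigr => i _.
by rewrite mxE; case: (u i 0) => [x y] /=; ring.
Qed.

Lemma rdotNl u w : rdot (- u) w = - rdot u w.
Proof. by rewrite -[in RHS]mulN1r -rdotZl rmorphN1 scaleN1r. Qed.

Lemma rdotDr u v w : rdot w (u + v) = rdot w u + rdot w v.
Proof. by rewrite rdotC rdotDl !(rdotC w). Qed.

Lemma rdotNr u w : rdot w (- u) = - rdot w u.
Proof. by rewrite rdotC rdotNl (rdotC w). Qed.

Lemma rdotZr a u w : rdot w (a%:C%C *: u) = a * rdot w u.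
Proof. by rewrite rdotC rdotZl (rdotC w). Qed.

Lemma rdot0l u : rdot 0 u = 0.
Proof. by rewrite -(scale0r (0 : 'cV[C]_n)) rdotZl mul0r. Qed.

Lemma rdot_ge0 u : 0 <= rdot u u.
Proof.
by rewrite rdotE sumr_ge0 // => i _; rewrite -!expr2 addr_ge0 ?sqr_ge0.
Qed.

Lemma norm2_ge0 u : 0 <= norm2 u.
Proof. exact: sqrtr_ge0. Qed.

Lemma norm2E u : norm2 u = Num.sqrt (rdot u u).
Proof. by rewrite rdot_inner. Qed.

Lemma sqr_norm2 u : norm2 u ^+ 2 = rdot u u.
Proof. by rewrite norm2E sqr_sqrtr ?rdot_ge0. Qed.

Lemma ler_norm2 u v : (norm2 u <= norm2 v) = (rdot u u <= rdot v v).
Proof. by rewrite !norm2E ler_sqrt ?rdot_ge0. Qed.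

Lemma norm2_0 : norm2 (0 : 'cV[C]_n) = 0.
Proof. by rewrite norm2E rdot0l sqrtr0. Qed.

Lemma norm2_eq0 u : norm2 u = 0 -> u = 0.
Proof.
move=> u0; apply/colP => i; rewrite mxE.
have /eqP := sqr_norm2 u; rewrite u0 expr0n /= eq_sym rdotE.
rewrite psumr_eq0 => [|j _]; last by rewrite -!expr2 addr_ge0 ?sqr_ge0.
move=> /allP/(_ i); rewrite mem_index_enum => /(_ isT) /=.
case: (u i 0) => x y /=.
by rewrite -!expr2 paddr_eq0 ?sqr_ge0 // !sqrf_eq0 => /andP[/eqP-> /eqP->].
Qed.

Lemma normc_unit_neq0 c : normc c = 1 -> c != 0.
Proof.
move=> c1; apply/eqP => c0; move/eqP: c1.
by rewrite c0 ComplexField.Normc.normc0 eq_sym oner_eq0.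
Qed.

Lemma normc_pos_real a : 0 <= a -> normc a%:C%C = a.
Proof. by move=> a0; rewrite /= expr0n /= addr0 sqrtr_sqr ger0_norm. Qed.

Lemma norm2Z c u : norm2 (c *: u) = normc c * norm2 u.
Proof.
have normc_ge0 : 0 <= normc c by case: c => x y; exact: sqrtr_ge0.
have e : rdot (c *: u) (c *: u) = normc c ^+ 2 * rdot u u.
  rewrite !rdotE big_distrr /=; apply: eq_bigr => i _.
  rewrite mxE; case: c (u i 0) {normc_ge0} => [x y] [z t] /=.
  by rewrite sqr_sqrtr ?addr_ge0 ?sqr_ge0 //; ring.
by rewrite !norm2E e sqrtrM ?sqr_ge0 // sqrtr_sqr ger0_norm.
Qed.

Lemma rdot_le u v : rdot u v <= norm2 u * norm2 v.
Proof.
have [/norm2_eq0->|u0] := eqVneq (norm2 u) 0.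
  by rewrite rdot0l norm2_0 mul0r.
have [/norm2_eq0->|v0] := eqVneq (norm2 v) 0.
  by rewrite rdotC rdot0l norm2_0 mulr0.
have u_gt0 : 0 < norm2 u by rewrite lt_def u0 norm2_ge0.
have v_gt0 : 0 < norm2 v by rewrite lt_def v0 norm2_ge0.
have := rdot_ge0 ((norm2 v)%:C%C *: u - (norm2 u)%:C%C *: v).
rewrite !(rdotDl, rdotDr, rdotNl, rdotNr, rdotZl, rdotZr).
rewrite -(sqr_norm2 u) -(sqr_norm2 v) (rdotC v u).
move: (norm2 u) (norm2 v) (rdot u v) u_gt0 v_gt0 => p q r p0 q0 h.
rewrite -subr_ge0 -(pmulr_rge0 _ (mulr_gt0 (@ltr0Sn R 1) (mulr_gt0 p0 q0))).
by move: h; congr (0 <= _); ring.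
Qed.

Lemma norm2D u v : norm2 (u + v) <= norm2 u + norm2 v.
Proof.
rewrite -(@ler_pXn2r _ 2) ?nnegrE ?addr_ge0 ?norm2_ge0 //.
rewrite (sqr_norm2 (u + v)) rdotDl !rdotDr -(sqr_norm2 u) -(sqr_norm2 v).
rewrite (rdotC v u); have := rdot_le u v.
move: (norm2 u) (norm2 v) (rdot u v) => p q r h.
rewrite -subr_ge0; rewrite -subr_ge0 in h; apply: le_trans (mulrn_wge0 2 h) _.
by rewrite le_eqVlt; apply/orP; left; apply/eqP; ring.
Qed.

Lemma norm2N u : norm2 (- u) = norm2 u.
Proof. by rewrite !norm2E rdotNl rdotNr opprK. Qed.

Lemma norm2B u v : norm2 (u - v) = norm2 (v - u).
Proof. by rewrite -norm2N opprB. Qed.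

(** On the unit sphere, balls around [v] are cut out by half-spaces. *)
Lemma norm2_unit_sub u v a : norm2 u = 1 -> norm2 v = 1 -> 0 <= a ->
  (norm2 (u - v) <= a) = (1 - a ^+ 2 / 2 <= rdot u v).
Proof.
move=> u1 v1 a0.
have expand : norm2 (u - v) ^+ 2 = 2 - 2 * rdot u v.
  rewrite (sqr_norm2 (u - v)) !(rdotDl, rdotDr, rdotNl, rdotNr) (rdotC v u).
  by rewrite -(sqr_norm2 u) -(sqr_norm2 v) u1 v1; ring.
rewrite -(ler_pXn2r (ltn0Sn 1) (norm2_ge0 (u - v)) a0) expand.
by apply/idP/idP => h; clear -h; lra.
Qed.

Lemma inner_unitary A u v :
  A \is unitarymx -> inner (A *m u) (A *m v) = inner u v.
Proof.
rewrite -trmx_unitary => /unitarymxP AA.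
rewrite /inner !dotmxE !trmx_mul map_mxM !mulmxA -[X in X *m _]mulmxA.
by rewrite AA mulmx1.
Qed.

Lemma rdot_unitary A u v :
  A \is unitarymx -> rdot (A *m u) v = rdot u (invmx A *m v).
Proof.
move=> uA; rewrite !rdot_inner -(inner_unitary u (invmx A *m v) uA) mulmxA.
by rewrite mulmxV ?unitarymx_unit ?mul1mx.
Qed.

Lemma norm2_unitary A u : A \is unitarymx -> norm2 (A *m u) = norm2 u.
Proof. by move=> uA; rewrite /norm2 inner_unitary. Qed.

End RealInnerProduct.

(** * Fixed vectors of semigroups of unitary matrices *)

Section FixedPoint.

Set Implicit Arguments.
Unset Strict Implicit.
Import numFieldNormedType.Exports.

Context {R : realType} {n : nat}.
Local Notation C := R[i].
Implicit Types (A B : 'M[C]_n) (u v w : 'cV[C]_n).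

Definition realify v : 'rV[R]_(n + n) :=
  row_mx (\row_i complex.Re (v i 0)) (\row_i complex.Im (v i 0)).

Definition complexify (x : 'rV[R]_(n + n)) : 'cV[C]_n :=
  \col_i (x 0 (lshift n i) +i* x 0 (rshift n i))%C.

Lemma realifyK v : complexify (realify v) = v.
Proof.
apply/colP => i; rewrite mxE row_mxEl row_mxEr !mxE.
by case: (v i 0).
Qed.

Lemma continuous_rdot (T : topologicalType) (f g : T -> 'cV[C]_n) :
  (forall i, continuous (fun x => complex.Re (f x i 0))) ->
  (forall i, continuous (fun x => complex.Im (f x i 0))) ->
  (forall i, continuous (fun x => complex.Re (g x i 0))) ->
  (forall i, continuous (fun x => complex.Im (g x i 0))) ->
  continuous (fun x => rdot (f x) (g x)).
Proof.
move=> f1 f2 g1 g2.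
have -> : (fun x => rdot (f x) (g x)) = (fun x =>
  \sum_i (complex.Re (f x i 0) * complex.Re (g x i 0) +
          complex.Im (f x i 0) * complex.Im (g x i 0))).
  by apply: boolp.funext => x; rewrite rdotE.
apply: continuous_big => [|i _ x]; first exact: add_continuous.
by apply: cvgD; apply: cvgM; [exact: f1 | exact: g1 | exact: f2 | exact: g2].
Qed.

Lemma continuous_complexify (i : 'I_n) :
  continuous (fun x => complex.Re (complexify x i 0)) /\
  continuous (fun x => complex.Im (complexify x i 0)).
Proof.
split;
  [ have -> : (fun x => complex.Re (complexify x i 0)) =
              (fun x => x 0 (lshift n i))
  | have -> : (fun x => complex.Im (complexify x i 0)) =
              (fun x => x 0 (rshift n i)) ];
  by [apply: boolp.funext => x; rewrite mxE | exact: coord_continuous].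
Qed.

Lemma coord_le_norm2 (x : 'rV[R]_(n + n)) j : `|x 0 j| <= norm2 (complexify x).
Proof.
rewrite -sqrtr_sqr norm2E ler_sqrt ?rdot_ge0 // rdotE.
pose q (k : 'I_n) :=
  complex.Re (complexify x k 0) * complex.Re (complexify x k 0) +
  complex.Im (complexify x k 0) * complex.Im (complexify x k 0).
have q_ge0 k : 0 <= q k by rewrite /q -!expr2 addr_ge0 ?sqr_ge0.
have [k kj] : exists k, x 0 j ^+ 2 <= q k.
  case: (split_ordP j) => k ->; exists k; rewrite /q mxE /= -!expr2.
    by rewrite lerDl sqr_ge0.
  by rewrite lerDr sqr_ge0.
rewrite (bigD1 k) //=; apply: (le_trans kj).
by rewrite lerDl; apply: sumr_ge0 => l _; exact: q_ge0.
Qed.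

(** [F] is a family of closed half-spaces [Re <v, w> <= s], coded by the pairs
    [(w, s)].  Their intersection is closed, and its part of norm at most
    [norm2 v0] is compact, so the norm attains its minimum there. *)
Lemma smallest_point (F : set ('cV[C]_n * R)) v0 :
  (forall p, F p -> rdot v0 p.1 <= p.2) ->
  exists v, (forall p, F p -> rdot v p.1 <= p.2) /\
    forall w, (forall p, F p -> rdot w p.1 <= p.2) -> norm2 v <= norm2 w.
Proof.
move=> Fv0.
pose sq x := rdot (complexify x) (complexify x).
have csq : continuous sq.
  by apply: continuous_rdot => i; case: (continuous_complexify i).
have clin w : continuous (fun x => rdot (complexify x) w).
  by apply: continuous_rdot => i; try exact: cst_continuous;
     case: (continuous_complexify i).
pose D := (\bigcap_(p in F) [set x | rdot (complexify x) p.1 <= p.2]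
   `&` [set x | sq x <= rdot v0 v0])%classic.
have D0 : D (realify v0).
  by split=> [p Fp|] /=; rewrite /sq realifyK //; exact: Fv0.
have cD : compact D.
  apply: bounded_closed_compact.
    exists (norm2 v0); split; first exact: num_real.
    move=> M ltM x [_ /= xle].
    rewrite [leLHS]/Num.norm /= mx_normrE; apply/bigmax_leP => /=; split.
      by rewrite (le_trans _ (ltW ltM)) ?norm2_ge0.
    move=> [i j] _ /=; rewrite (ord1 i); apply: le_trans (ltW ltM).
    by apply: le_trans (coord_le_norm2 x j) _; rewrite ler_norm2; exact: xle.
  apply: closedI.
    apply: closed_bigI => p _.
    apply: (preimage_closed (D := [set y | y <= p.2]%classic));
      last exact: closed_le.
    by move=> x _; exact: clin.
  apply: (preimage_closed (D := [set y | y <= rdot v0 v0]%classic));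
    last exact: closed_le.
  by move=> x _; exact: csq.
have [|x] := EVT_min_rV (ex_intro _ _ D0) cD (f := sq).
  exact: continuous_subspaceT.
move=> /set_mem[xF xv0] xmin; exists (complexify x); split=> [p|w wF].
  exact: (xF p).
rewrite ler_norm2.
have /orP[wv0|v0w] := le_total (rdot w w) (rdot v0 v0);
  last exact: le_trans xv0 v0w.
suff /xmin : realify w \in D by rewrite /sq realifyK.
by apply: mem_set; split=> [p Fp|] /=; rewrite /sq realifyK;
  [exact: wF | exact: wv0].
Qed.

(** The fixed vector is the point [v] of smallest norm of the closed convex hull
    of the orbit of [v0], that is of the intersection of the half-spaces that
    contain the orbit.  This hull is stable under the semigroup [S], so [A v]
    and the midpoint of [v] and [A v] lie in it.  As [A v] and [v] have the same
    norm, they are equal by the parallelogram identity.  Defining the hull by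
    half-spaces makes the last bound immediate. *)
Lemma fixed_point (S : set 'M[C]_n) v0 (t : R) :
  S 1%:M -> (forall A B, S A -> S B -> S (A *m B)) ->
  (forall A, S A -> A \is unitarymx) ->
  (forall A, S A -> t <= rdot (A *m v0) v0) ->
  exists v, [/\ forall A, S A -> A *m v = v,
    norm2 v <= norm2 v0 & t <= rdot v v0].
Proof.
move=> S1 SM SU St.
have half_le (a b c : R) : a <= c -> b <= c -> 2^-1 * (a + b) <= c by lra.
have midpoint_le (a b : R) : a <= 2^-1 * (2^-1 * (a + b) + 2^-1 * (b + a)) ->
  a - b - (b - a) <= 0 by lra.
pose F : set ('cV[C]_n * R) :=
  [set p | forall A, S A -> rdot (A *m v0) p.1 <= p.2]%classic.
have F0 p : F p -> rdot v0 p.1 <= p.2.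
  by move=> /(_ _ S1); rewrite mul1mx.
have [v [vF vmin]] := smallest_point F0.
exists v; split; last first.
- have /vF/= : F (- v0, - t) by move=> A SA /=; rewrite rdotNr lerN2 St.
  by rewrite rdotNr lerN2.
- exact: vmin.
move=> A SA.
have AvF p : F p -> rdot (A *m v) p.1 <= p.2.
  case: p => w s Fws /=; rewrite rdot_unitary ?SU //.
  apply: (vF (invmx A *m w, s)) => B SB /=.
  by rewrite -rdot_unitary ?SU // mulmxA; exact/Fws/SM.
have /vmin : forall p, F p -> rdot ((2^-1)%:C%C *: (v + A *m v)) p.1 <= p.2.
  by move=> p Fp; rewrite rdotZl rdotDl; apply: half_le;
     [exact: vF | exact: AvF].
have nA : rdot (A *m v) (A *m v) = rdot v v.
  by rewrite rdot_unitary ?mulmxA ?mulVmx ?mul1mx ?unitarymx_unit ?SU.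
rewrite ler_norm2 => h.
apply/eqP; rewrite -subr_eq0; apply/eqP/norm2_eq0/eqP.
rewrite -sqrf_eq0 eq_le sqr_ge0 andbT (sqr_norm2 (_ - _)).
move: h; rewrite !(rdotZl, rdotZr, rdotDl, rdotDr, rdotNl, rdotNr) nA.
by rewrite (rdotC v (A *m v)); exact: midpoint_le.
Qed.

End FixedPoint.

(** * Commutators of matrices that almost fix a vector up to a phase *)

Section AlmostFixed.

Set Implicit Arguments.
Unset Strict Implicit.

Context {R : realType} {n : nat}.
Local Notation C := R[i].
Local Notation normc := ComplexField.Normc.normc.
Implicit Types (A B : 'M[C]_n) (u : 'cV[C]_n).

Lemma near_scalar_mul A B (a b : C) (r s : R) u :
  A \is unitarymx -> normc b = 1 ->
  norm2 (A *m u - a *: u) <= r -> norm2 (B *m u - b *: u) <= s ->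
  norm2 (A *m B *m u - (a * b) *: u) <= r + s.
Proof.
move=> uA b1 hA hB.
have -> : A *m B *m u - (a * b) *: u =
    b *: (A *m u - a *: u) + A *m (B *m u - b *: u).
  rewrite mulmxBr mulmxA scalerBr -scalemxAr scalerA [RHS]addrC [b * a]mulrC.
  by rewrite subrKA.
apply: le_trans (norm2D _ _) _.
by rewrite norm2Z b1 mul1r norm2_unitary //; exact: lerD.
Qed.

Lemma near_scalar_inv A (a : C) u : A \is unitarymx -> normc a = 1 ->
  norm2 (invmx A *m u - a^-1 *: u) = norm2 (A *m u - a *: u).
Proof.
move=> uA a1.
have -> : A *m u - a *: u = - (a *: (A *m (invmx A *m u - a^-1 *: u))).
  rewrite mulmxBr mulmxA mulmxV ?unitarymx_unit // mul1mx -scalemxAr.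
  by rewrite scalerBr scalerA divff ?normc_unit_neq0 // scale1r opprB.
by rewrite norm2N norm2Z a1 mul1r norm2_unitary.
Qed.

(** The phase [a] is that of [<A u, u>], which makes [<A u, a u>] equal to
    [|<A u, u>|]. *)
Lemma near_phase A (e : R) u :
  A \is unitarymx -> norm2 u = 1 -> 0 <= e -> e < 1 ->
  (1 - e)%:C%C <= `|inner (A *m u) u| ->
  exists2 a : C, normc a = 1 & norm2 (A *m u - a *: u) <= Num.sqrt (2 * e).
Proof.
move=> uA u1 e0 e1.
set z := inner _ _ => le_z.
have {}le_z : 1 - e <= normc z by rewrite -lecR.
have z0 : 0 < normc z by apply: lt_le_trans le_z; rewrite subr_gt0.
have a1 : normc (((normc z)^-1)%:C%C * z) = 1.
  rewrite ComplexField.Normc.normcM normc_pos_real ?invr_ge0 ?ltW //.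
  by rewrite mulVf // gt_eqF.
exists (((normc z)^-1)%:C%C * z) => //.
have Au1 : norm2 (A *m u) = 1 by rewrite norm2_unitary.
have au1 : norm2 ((((normc z)^-1)%:C%C * z) *: u) = 1.
  by rewrite norm2Z a1 u1 mulr1.
rewrite (norm2_unit_sub Au1 au1 (sqrtr_ge0 _)) sqr_sqrtr; last exact: mulr_ge0.
rewrite -scalerA rdotZr.
suff -> : rdot (A *m u) (z *: u) = normc z ^+ 2.
  rewrite expr2 mulrA mulVf ?mul1r; last by rewrite gt_eqF.
  by clear -le_z; lra.
have -> : rdot (A *m u) (z *: u) = complex.Re (z * z^*).
  by rewrite rdot_inner innerZr mulrC.
case: z {le_z z0 a1 au1} => x y /=.
by rewrite sqr_sqrtr ?addr_ge0 ?sqr_ge0 //; ring.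
Qed.

Lemma mxcommutator_near A B (e : R) u :
  A \is unitarymx -> B \is unitarymx -> norm2 u = 1 -> 0 <= e -> e < 1 ->
  (1 - e)%:C%C <= `|inner (A *m u) u| -> (1 - e)%:C%C <= `|inner (B *m u) u| ->
  norm2 (mxcommutator A B *m u - u) <= 4 * Num.sqrt (2 * e).
Proof.
move=> uA uB u1 e0 e1 /(near_phase uA u1 e0 e1)[a a1 hA].
move=> /(near_phase uB u1 e0 e1)[b b1 hB].
have inv1 (c : C) : normc c = 1 -> normc c^-1 = 1.
  by move=> c1; rewrite ComplexField.Normc.normcV c1 invr1.
have uA' : invmx A \is unitarymx.
  by rewrite (invmx_unitary uA) trmxC_unitary; exact uA.
have uAB := mul_unitarymx uA uB.
have uABA := mul_unitarymx uAB uA'.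
have hAB := near_scalar_mul uA b1 hA hB.
rewrite -(near_scalar_inv u uA a1) in hA.
rewrite -(near_scalar_inv u uB b1) in hB.
have hABA := near_scalar_mul uAB (inv1 _ a1) hAB hA.
have := near_scalar_mul uABA (inv1 _ b1) hABA hB.
rewrite [a * b]mulrC mulfK ?normc_unit_neq0 // divff ?normc_unit_neq0 // scale1r.
by move/le_trans; apply; rewrite le_eqVlt; apply/orP; left; apply/eqP; ring.
Qed.

Lemma near_root1 (c : C) u : (0 < n)%N -> c ^+ n = 1 -> norm2 u = 1 ->
  n%:R * norm2 (c *: u - u) < 4 -> c = 1.
Proof.
move=> n0 cn u1 lt4; apply/eqP; apply: contraLR lt4 => c1.
rewrite -leNgt -[X in _ - X]scale1r -scalerBl norm2Z u1 mulr1.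
have := @root1_gap _ _ _ n0 cn c1.
by rewrite -lecR rmorphM /= !rmorph_nat.
Qed.

End AlmostFixed.

(** * Common eigenvectors *)

Theorem theorem3p6 (R : realType) (n : nat) (eps : R)
    (n_ge2 : (2 <= n)%N) (eps_gt0 : 0 < eps)
    (eps_lt : eps < 1 / (32 * n%:R ^+ 2))
    (G : set 'M[R[i]]_n) (groupG : unitary_group G)
    (commG : forall X : 'M[R[i]]_n, G X ->
       exists (A B : 'M[R[i]]_n) (c : R[i]),
         [/\ G A, G B & X = c *: mxcommutator A B])
    (xi : 'cV[R[i]]_n) (xi_fixed : is_weak_approx_fixed_point G eps xi) :
  exists eta : 'cV[R[i]]_n,
    is_common_eigenvector G eta /\
    norm2 (xi - eta) <= 4 * Num.sqrt (2 * eps) < 1 / n%:R.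
Proof.
case: groupG => GU G1 GM GV; case: xi_fixed => xi1 xiG.
have n_gt0 : 0 < n%:R :> R by rewrite ltr0n ltnW.
have n2 : 2 <= n%:R :> R by rewrite ler_nat.
have sqr_half (x : R) : 0 <= x -> 2 * x < 1 -> x ^+ 2 < 1 by nra.
have half_gt0 (x : R) : x < 1 -> 0 < 1 - x / 2 by lra.
have eps_small : 32 * eps < 1 -> eps < 1 by clear -eps_gt0; lra.
have three_lt4 (x y : R) : x * y < 1 -> x * (y + (y + y)) < 4 by lra.
set d := 4 * _.
have d0 : 0 <= d by rewrite mulr_ge0 ?sqrtr_ge0.
have dE : d ^+ 2 = 32 * eps.
  by rewrite exprMn sqr_sqrtr ?mulr_ge0 ?ltW //; ring.
have lt_d : d < 1 / n%:R.
  rewrite -(ltr_pXn2r (ltn0Sn 1)) ?nnegrE ?d0 ?divr_ge0 ?ler01 ?(ltW n_gt0) //.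
  rewrite dE expr_div_n expr1n -ltr_pdivlMl //.
  apply: lt_le_trans eps_lt _.
  by rewrite !div1r invfM.
have nd : n%:R * d < 1 by rewrite mulrC -(ltr_pdivlMr _ _ n_gt0); exact lt_d.
have d_half : 2 * d < 1 by apply: le_lt_trans nd; exact: ler_wpM2r.
have sqr_d : d ^+ 2 < 1 := sqr_half d d0 d_half.
have lt_d2 : 1 - d ^+ 2 / 2 > 0 := half_gt0 (d ^+ 2) sqr_d.
have eps1 : eps < 1.
  apply: eps_small; move: sqr_d; rewrite dE; exact.
pose K X := [/\ G X, \det X = 1 & norm2 (X *m xi - xi) <= d].
have K_comm A B : G A -> G B -> K (mxcommutator A B).
  move=> GA GB; split.
  - by rewrite /mxcommutator; do !apply: (GM); try apply: GV.
  - rewrite /mxcommutator !det_mulmx !det_inv -mulrA -invfM.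
    by rewrite divff // mulf_neq0 // -unitfE -unitmxE unitarymx_unit ?GU.
  - exact (mxcommutator_near (GU _ GA) (GU _ GB) xi1 (ltW eps_gt0) eps1
      (xiG _ GA) (xiG _ GB)).
clearbody d.
have K1 : K 1%:M.
  by split; rewrite ?det1 // mul1mx subrr norm2_0.
(* [K] is not visibly closed under products: the estimate for [A B] is [2 d],
   and only the gap between the roots of unity brings it back to [d]. *)
have KM A B : K A -> K B -> K (A *m B).
  move=> [GA detA hA] [GB detB hB].
  have [A' [B' [c [GA' GB' ABE]]]] := commG _ (GM _ _ GA GB).
  have [_ detC hC] := K_comm _ _ GA' GB'.
  have cn : c ^+ n = 1.
    by rewrite -[LHS]mulr1 -detC -detZ -ABE det_mulmx detA detB mulr1.
  suff c1 : c = 1 by rewrite ABE c1 scale1r; exact: K_comm.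
  apply: (near_root1 _ cn xi1); first exact: ltnW.
  (* At [xi], [A] and [B] are within [d] of the scalar 1, so [A B] is within [2 d] of it,
     and within [d] of [c]. *)
  have c_norm : ComplexField.Normc.normc c = 1.
    have := norm2_unitary xi (GU _ (GM _ _ GA GB)).
    rewrite ABE -scalemxAl norm2Z norm2_unitary ?xi1 ?mulr1 //.
    by apply: GU; case: (K_comm _ _ GA' GB').
  have hAB := near_scalar_mul (a := 1) (b := 1) (GU _ GA)
    (ComplexField.Normc.normc1 R).
  have {}hAB : norm2 (A *m B *m xi - xi) <= d + d.
    by have := hAB B d d xi; rewrite mulr1 !scale1r => /(_ hA hB).
  have h : norm2 (c *: xi - xi) <= d + (d + d).
    have -> : c *: xi - xi = (c *: xi - A *m B *m xi) + (A *m B *m xi - xi).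
      by rewrite subrKA.
    apply: le_trans (norm2D _ _) _; apply: lerD (hAB).
    by rewrite norm2B ABE -scalemxAl -scalerBr norm2Z c_norm mul1r.
  apply: le_lt_trans (_ : n%:R * (d + (d + d)) < 4); first by rewrite ler_pM2l.
  exact: three_lt4.
have KU A : K A -> A \is unitarymx by case=> /GU.
have K_rdot A : K A -> 1 - d ^+ 2 / 2 <= rdot (A *m xi) xi.
  by move=> KA; rewrite -norm2_unit_sub ?norm2_unitary ?KU //; case: KA.
(* [v] lies in the half-space of [K_rdot], which does not contain 0. *)
have [v [vK v_le v_ge]] := fixed_point K1 KM KU K_rdot.
have v_gt0 : 0 < norm2 v.
  rewrite lt_def norm2_ge0 andbT; apply: contraTneq v_ge => /norm2_eq0 ->.
  by rewrite -ltNge rdot0l.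
pose eta := ((norm2 v)^-1)%:C%C *: v.
have eta1 : norm2 eta = 1.
  by rewrite norm2Z normc_pos_real ?invr_ge0 ?ltW // mulVf ?gt_eqF.
exists eta; split; last first.
  rewrite lt_d andbT (norm2_unit_sub xi1 eta1 d0) rdotC rdotZl.
  rewrite [_ * rdot _ _]mulrC.
  rewrite (ler_pdivlMr _ _ v_gt0); apply: le_trans v_ge.
  by rewrite xi1 in v_le; exact: ler_piMr (ltW lt_d2) v_le.
split=> [|X GX]; first exact: eta1.
have [A [B [c [GA GB XE]]]] := commG _ GX.
by exists c; rewrite XE -scalemxAl -scalemxAr (vK _ (K_comm _ _ GA GB)).
Qed.
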